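(* In the proportional allocation mechanism with agents having subadditive valuations, the Bayesian Price of Anarchy is at most $2$: for every Bayesian instance and every Bayesian Nash equilibrium $\mathbf{B}$, $\mathbb{E}_{\mathbf{v}}[\mathrm{SW}(\mathbf{B}(\mathbf{v}))]\ge\frac12\mathbb{E}_{\mathbf{v}}[\mathrm{SW}(\mathbf{o}^{\mathbf{v}})]$.
   Context: There are $n$ agents and $m$ divisible resources, each of unit supply. Valuations $v_i:[0,1]^m\to\mathbb{R}_{\ge 0}$ satisfy $v_i(\mathbf{0})=0$, are monotone non-decreasing and subadditive ($v_i(\mathbf{x}+\mathbf{y})\le v_i(\mathbf{x})+v_i(\mathbf{y})$ whenever $\mathbf{x},\mathbf{y},\mathbf{x}+\mathbf{y}\in[0,1]^m$). Each $v_i$ is drawn independently from a publicly known distribution $D_i$ over a set $V_i$ of such valuations. Proportional allocation mechanism: each agent $i$ bids $b_{ij}\ge0$ on each resource $j$, receives fraction $x_{ij}=b_{ij}/\sum_k b_{kj}$ of resource $j$ (arbitrary but consistent when all bids on $j$ are $0$) and pays $\sum_j b_{ij}$; utility $u_i(\mathbf{b})=v_i(x_i(\mathbf{b}))-\sum_j b_{ij}$. $\mathrm{SW}(\mathbf{b})=\sum_iv_i(x_i(\mathbf{b}))$ and $\mathbf{o}^{\mathbf{v}}$ is a welfare-maximizing allocation (with $x_{ij}\ge0$, $\sum_i x_{ij}\le1$) for profile $\mathbf{v}$; $\mathbb{E}_{\mathbf{v}}[\mathrm{SW}(\mathbf{B}(\mathbf{v}))]$ denotes the expected welfare over $\mathbf{v}$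 and $\mathbf{b}\sim\mathbf{B}(\mathbf{v})$. A Bayesian Nash equilibrium is a profile $\mathbf{B}(\mathbf{v})=\times_iB_i(v_i)$, with $B_i(v_i)$ a distribution over agent $i$'s bid vectors, such that for every $i$, every $v_i$ and every bid vector $b_i'$, $\mathbb{E}_{\mathbf{v}_{-i},\mathbf{b}}[u_i(\mathbf{b})]\ge\mathbb{E}_{\mathbf{v}_{-i},\mathbf{b}}[u_i(b_i',\mathbf{b}_{-i})]$. *)

(* Defs.v *)
From HB Require Import structures.
From mathcomp Require Import all_boot all_order all_algebra.
From mathcomp Require Import all_classical all_reals all_analysis.

Set Implicit Arguments.
Unset Strict Implicit.
Unset Printing Implicit Defensive.

Import Order.TTheory GRing.Theory Num.Theory.
Local Open Scope ring_scope.
Local Open Scope classical_set_scope.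

(* Vectors in R^m (bids, fractions of resources) are m.-tuples, which carry
   the product sigma-algebra of the coordinate projections. *)

Section Defs.
Context {R : realType} {n m : nat}.

Definition in_cube (x : m.-tuple R) : Prop := forall j : 'I_m, 0 <= tnth x j <= 1.

Definition vzero : m.-tuple R := [tuple (0 : R) | j < m].
Definition vadd (x y : m.-tuple R) : m.-tuple R := [tuple tnth x j + tnth y j | j < m].
Definition vle (x y : m.-tuple R) : Prop := forall j : 'I_m, tnth x j <= tnth y j.

Definition subadditive_valuation (v : m.-tuple R -> R) : Prop :=
  [/\ v vzero = 0,
      (forall x, in_cube x -> 0 <= v x),
      (forall x y, in_cube x -> in_cube y -> vle x y -> v x <= v y) &
      (forall x y, in_cube x -> in_cube y -> in_cube (vadd x y) ->
         v (vadd x y) <= v x + v y)].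

Definition nonneg_bid (b : m.-tuple R) : Prop := forall j : 'I_m, 0 <= tnth b j.

(* Proportional allocation mechanism.  [z j] is the fixed ("arbitrary but
   consistent") allocation of resource j used when all bids on j are 0. *)
Definition total_bid (b : 'I_n -> m.-tuple R) (j : 'I_m) : R :=
  \sum_(k < n) tnth (b k) j.

Definition alloc (z : 'I_m -> 'I_n -> R) (b : 'I_n -> m.-tuple R) (i : 'I_n)
  : m.-tuple R :=
  [tuple (if total_bid b j == 0 then z j i else tnth (b i) j / total_bid b j)
   | j < m].

Definition payment (bi : m.-tuple R) : R := \sum_(j < m) tnth bi j.

Definition utility (v : m.-tuple R -> R) (z : 'I_m -> 'I_n -> R)
  (b : 'I_n -> m.-tuple R) (i : 'I_n) : R :=
  v (alloc z b i) - payment (b i).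

Definition upd (b : 'I_n -> m.-tuple R) (i : 'I_n) (b' : m.-tuple R)
  : 'I_n -> m.-tuple R := fun k => if k == i then b' else b k.

Definition feasible (x : 'I_n -> m.-tuple R) : Prop :=
  (forall i j, 0 <= tnth (x i) j) /\
  (forall j : 'I_m, \sum_(i < n) tnth (x i) j <= 1).

Definition tie_rule (z : 'I_m -> 'I_n -> R) : Prop :=
  (forall j i, 0 <= z j i) /\ (forall j, \sum_(i < n) z j i <= 1).

Definition welfare (vs : 'I_n -> m.-tuple R -> R) (x : 'I_n -> m.-tuple R) : R :=
  \sum_(i < n) vs i (x i).

End Defs.

(* Mutual independence of a finite family of random elements X_i with
   values in a measurable space U: product rule for every family of
   measurable events (taking A_i = setT gives all subfamilies). *)
Definition mutually_independent {R : realType} {d : measure_display}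
  {Omega : measurableType d} (P : probability Omega R)
  {dU : measure_display} {U : measurableType dU} (n : nat)
  (X : 'I_n -> Omega -> U) : Prop :=
  forall A : 'I_n -> set U, (forall i, measurable (A i)) ->
    P (\bigcap_(i in [set: 'I_n]) (X i @^-1` A i)) =
    (\prod_(i < n) P (X i @^-1` A i))%E.

(* Main.v *)
(* Fix an agent [i] of type [t] and any vector [y] of the cube.  Let [p] be the
   vector of total bids of the others and [p'] an independent copy of it.  Bidding
   [y p' + e] coordinatewise gives the share [(y p' + e) / (y p' + e + p)], which,
   added to the one obtained by exchanging [p] and [p'], is at least [y]; by
   subadditivity the expected value of the deviation is at least [v y / 2], and it
   costs [y . E p] up to [e].  The equilibrium condition thus bounds the interim
   utility of [i] below by [v y / 2 - y . E p].  Taking [y] to be the share of [i]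
   in a welfare-maximizing allocation and summing over agents, the costs add up to
   at most the expected revenue, which cancels the payments contained in the
   utilities.  The bound holds for every [y], so it applies state by state to the
   optimal allocation, which may be a nonmeasurable function of the types. *)
Require Import Defs.
From HB Require Import structures.
From mathcomp Require Import all_boot all_order all_algebra.
From mathcomp Require Import all_classical all_reals all_analysis.
From mathcomp Require Import measurable_realfun ring lra.

Set Implicit Arguments.
Unset Strict Implicit.
Unset Printing Implicit Defensive.

Import Order.TTheory GRing.Theory Num.Theory.
Local Open Scope ring_scope.
Local Open Scope classical_set_scope.
Import numFieldNormedType.Exports.

(** * Independence and disintegration *)

Section tuple_measurability.
Context {d : measure_display} {S : measurableType d} {n : nat}.

Definition tuple_box (A : 'I_n -> set S) : set (n.-tuple S) :=
  [set y | forall k, A k (tnth y k)].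

Lemma measurable_tuple_box (A : 'I_n -> set S) :
  (forall k, measurable (A k)) -> measurable (tuple_box A).
Proof.
move=> mA.
have -> : tuple_box A =
    \bigcap_(k in [set: 'I_n]) ((fun y : n.-tuple S => tnth y k) @^-1` A k).
  by apply/seteqP; split => [y Ay k _|y Ay k]; [exact: Ay|exact: Ay].
apply: fin_bigcap_measurable => //.
by move=> k _; rewrite -[X in measurable X]setTI; exact: measurable_tnth.
Qed.

(** Boxes, unlike preimages under a single coordinate, are stable under intersection, which is what
    Dynkin induction asks of a generating family. *)
Lemma measurable_tuple_boxes :
  @measurable _ (n.-tuple S) =
  <<s [set tuple_box A | A in [set A | forall k, measurable (A k)]] >>.
Proof.
apply/seteqP; split.
  apply: smallest_sub; first exact: smallest_sigma_algebra.
  rewrite -bigcup_seq => B [i _ [C mC <-]].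
  apply: sub_sigma_algebra; exists (fun k => if k == i then C else setT).
    by move=> k; case: ifP.
  apply/seteqP; split => [y /(_ i)|y [_ Cy] k] /=; first by rewrite eqxx.
  by case: eqP => // ->.
apply: smallest_sub; first exact: sigma_algebra_measurable.
by move=> B [A mA <-]; exact: measurable_tuple_box.
Qed.

Lemma setI_closed_tuple_box :
  setI_closed [set tuple_box A | A in [set A | forall k, measurable (A k)]].
Proof.
move=> _ _ [A mA <-] [B mB <-]; exists (fun k => A k `&` B k).
  by move=> k; exact: measurableI.
apply/seteqP; split => [y AB|y [Ay By] k]; last by split.
by split => k; have [] := AB k.
Qed.

End tuple_measurability.

Section independent_integral.
Local Open Scope ereal_scope.
Context {R : realType} {d dS dU : measure_display} {Omega : measurableType d}
  {S : measurableType dS} {U : measurableType dU} (P : probability Omega R).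

(** The product rule on rectangles makes the joint law of [X] and [Y] the product of their laws, and
    Tonelli applies. Both integrals are pulled back to [Omega], where [w'] acts as an independent
    copy of [w]. *)
Lemma ge0_integral_independent (X : Omega -> S) (Y : Omega -> U)
    (F : S * U -> \bar R) :
  measurable_fun setT X -> measurable_fun setT Y ->
  (forall A B, measurable A -> measurable B ->
    P (X @^-1` A `&` Y @^-1` B) = P (X @^-1` A) * P (Y @^-1` B)) ->
  measurable_fun [set: S * U] F -> (forall p, 0 <= F p) ->
  \int[P]_w F (X w, Y w) = \int[P]_w \int[P]_w' F (X w, Y w').
Proof.
move=> mX mY XY mF F0.
pose X' : {mfun Omega >-> S} := mfun_Sub (mem_set mX).
pose Y' : {mfun Omega >-> U} := mfun_Sub (mem_set mY).
have mXY : measurable_fun setT (fun w => (X w, Y w)) by exact: measurable_fun_pair.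
pose XY' : {mfun Omega >-> (S * U)%type} := mfun_Sub (mem_set mXY).
transitivity (\int[distribution P XY']_p F p).
  by rewrite ge0_integral_distribution.
transitivity (\int[(distribution P X' \x distribution P Y')%E]_p F p).
  apply: eq_measure_integral => A mA _.
  by apply/esym/product_measure_unique => // B C mB mC; rewrite -XY.
rewrite fubini_tonelli1// ge0_integral_distribution//; last 2 first.
- exact: measurable_fun_fubini_tonelli_F.
- by move=> x; exact: integral_ge0.
apply: eq_integral => w _ /=.
by rewrite /fubini_F ge0_integral_distribution//; exact: measurableT_comp.
Qed.

End independent_integral.

(** * Independence of one agent's data from those of the others *)

Section leave_one_out.
Context {R : realType} {d dS dU : measure_display} {Omega : measurableType d}
  {S : measurableType dS} {U : measurableType dU} (P : probability Omega R)
  {n : nat}.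
Variables (X : 'I_n -> Omega -> S) (g : S -> U) (c : U).

(** Entry [i] is filled with a constant instead of being removed, so that the tuple keeps length
    [n]. *)
Definition leave_out (i : 'I_n) (w : Omega) : n.-tuple U :=
  [tuple if k == i then c else g (X k w) | k < n].

Hypothesis mX : forall i, measurable_fun setT (X i).
Hypothesis mg : measurable_fun setT g.

Lemma measurable_leave_out i : measurable_fun setT (leave_out i).
Proof.
apply/measurable_fun_tnthP => k.
rewrite (_ : _ \o _ = fun w => if k == i then c else g (X k w)); last first.
  by apply/funext => w /=; rewrite tnth_mktuple.
by case: (k == i) => //; exact: measurableT_comp.
Qed.

(** Dynkin induction on [B]: for boxes the claim follows from mutual independence, and it passes to
    complements and disjoint unions. *)
Lemma independent_leave_out i (A : set S) (B : set (n.-tuple U)) :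
  mutually_independent P X -> measurable A -> measurable B ->
  (P (X i @^-1` A `&` leave_out i @^-1` B) =
   P (X i @^-1` A) * P (leave_out i @^-1` B))%E.
Proof.
move=> PX mA; move: B.
have mXA : measurable (X i @^-1` A).
  by rewrite -[X in measurable X]setTI; exact: mX.
have mY B : measurable B -> measurable (leave_out i @^-1` B).
  by move=> mB; rewrite -[X in measurable X]setTI; exact: measurable_leave_out.
rewrite (@measurable_tuple_boxes _ U n); apply: dynkin_induction.
- exact: measurable_tuple_boxes.
- exact: setI_closed_tuple_box.
- by rewrite preimage_setT setIT probability_setT mule1.
- move=> _ [B mB <-].
  have [cB|cB] := pselect (B i c); last first.
    suff -> : leave_out i @^-1` tuple_box B = set0.
      by rewrite setI0 measure0 mule0.
    rewrite -subset0 => w /(_ i); rewrite /leave_out tnth_mktuple eqxx.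
    exact: cB.
  (* Events on all agents at once: [D] for agent [i], the box condition for the others. Taking [D]
     to be [A], then [setT], turns both probabilities involving the box into products over
     agents. *)
  pose C (D : set S) k := if k == i then D else g @^-1` B k.
  have mC D k : measurable D -> measurable (C D k).
    move=> mD; rewrite /C; case: ifP => // _.
    by rewrite -[X in measurable X]setTI; exact: mg.
  have CE D : X i @^-1` D `&` leave_out i @^-1` tuple_box B =
      \bigcap_(k in [set: 'I_n]) (X k @^-1` C D k).
    apply/seteqP; split => [w [Dw Bw] k _|w CD] /=.
      rewrite /C; case: ifPn => [/eqP -> //|ki]; have := Bw k.
      by rewrite tnth_mktuple (negbTE ki).
    split; first by have := CD i I; rewrite /C /= eqxx.
    move=> k; rewrite tnth_mktuple; case: ifPn => [/eqP -> //|ki].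
    by have := CD k I; rewrite /C /= (negbTE ki).
  rewrite CE -[in RHS](setTI (leave_out _ @^-1` _)) -(preimage_setT (X i)) CE.
  rewrite !PX; [|by move=> k; exact: mC|by move=> k; exact: mC].
  rewrite (bigD1 i)//= [in RHS](bigD1 i)//= {1 3}/C eqxx preimage_setT.
  rewrite probability_setT mul1e; congr (_ * _)%E.
  by apply: eq_bigr => k ki; rewrite /C (negbTE ki).
- move=> B /mY; set E := leave_out i @^-1` B => mE IH.
  change (P (X i @^-1` A `&` ~` E) = P (X i @^-1` A) * P (~` E))%E.
  rewrite -setDE measureD//; last by rewrite ltey_eq fin_num_measure.
  rewrite probability_setC// muleBr ?fin_num_measure// ?fin_num_adde_defr// mule1.
  by congr (_ - _)%E; exact: IH.
- move=> F mF tF IH.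
  have tY : trivIset setT (fun k => leave_out i @^-1` F k).
    by move=> a b _ _ [w [Fa Fb]]; apply: tF => //; exists (leave_out i w).
  rewrite preimage_bigcup setI_bigcupr measure_bigcup//=; last 2 first.
  - by move=> k _; apply: measurableI => //; exact: mY.
  - exact: trivIset_setIl.
  rewrite measure_bigcup//=; last by move=> k _; exact: mY.
  rewrite (eq_eseriesr (fun k _ => IH k)).
  rewrite -(fineK (fin_num_measure P _ mXA)) -nneseriesZl//.
Qed.

End leave_one_out.

(** * Joint law of type and bid *)

Section graph_kernel.
Local Open Scope ereal_scope.
Context {R : realType} {d dT dU : measure_display} {Omega : measurableType d}
  {T : measurableType dT} {U : measurableType dU}.
Variables (B : R.-pker T ~> U) (tv : Omega -> T).
Hypothesis mtv : measurable_fun setT tv.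

Lemma measurable_pairl (t : T) : measurable_fun [set: U] (pair t).
Proof. exact: measurable_fun_pair. Qed.

(* The conditional law of (type, bid) given the state; the dummy [unit] factor
   is the parameter space required by the library's kernel composition. *)
Definition graph_kernel (m : measurable_fun setT tv) (p : unit * Omega) :
    {measure set (T * U) -> \bar R} :=
  measure_function_pushforward__canonical__measure_function_Measure
    (B (tv p.2)) (measurable_pairl (tv p.2)).

Lemma graph_kernelE (m : measurable_fun setT tv) p (C : set (T * U)) :
  graph_kernel m p C = B (tv p.2) (xsection C (tv p.2)).
Proof. by rewrite /graph_kernel /= /pushforward xsectionE. Qed.

Let measurable_graph_kernel C : measurable C ->
  measurable_fun [set: unit * Omega] ((graph_kernel mtv) ^~ C).
Proof.
move=> mC; rewrite (_ : (fun p => _) =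
    (fun t => B t (xsection C t)) \o (tv \o snd)); last first.
  by apply/funext => p; rewrite graph_kernelE.
apply: measurableT_comp; last exact: measurableT_comp.
apply: measurable_fun_xsection_finite_kernel; rewrite inE; exact: mC.
Qed.

HB.instance Definition _ := isKernel.Build _ _ _ _ _ (graph_kernel mtv)
  measurable_graph_kernel.

Let graph_kernel_prob p : graph_kernel mtv p [set: T * U] = 1.
Proof. exact: prob_kernel. Qed.

HB.instance Definition _ := Kernel_isProbability.Build _ _ _ _ _
  (graph_kernel mtv) graph_kernel_prob.

End graph_kernel.

Section disintegration.
Local Open Scope ereal_scope.
Context {R : realType} {d dT dU : measure_display} {Omega : measurableType d}
  {T : measurableType dT} {U : measurableType dU} (P : probability Omega R).
Variables (B : R.-pker T ~> U) (tv : Omega -> T) (bid : Omega -> U).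
Hypothesis mtv : measurable_fun setT tv.
Hypothesis mbid : measurable_fun setT bid.
Hypothesis law : forall (A : set T) (S : set U), measurable A -> measurable S ->
  P (tv @^-1` A `&` bid @^-1` S) = \int[P]_(w in tv @^-1` A) B (tv w) S.

(** [law] fixes the joint law of type and bid on rectangles, hence everywhere: it is the composition
    of [P] with [graph_kernel], and an integral against a composition is iterated. *)
Lemma ge0_integral_disintegration (F : T * U -> \bar R) :
  measurable_fun [set: T * U] F -> (forall p, 0 <= F p) ->
  \int[P]_w F (tv w, bid w) = \int[P]_w \int[B (tv w)]_b F (tv w, b).
Proof.
move=> mF F0.
have mX : measurable_fun setT (fun w => (tv w, bid w)) by exact: measurable_fun_pair.
pose X : {mfun Omega >-> (T * U)%type} := mfun_Sub (mem_set mX).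
transitivity (\int[distribution P X]_p F p).
  by rewrite ge0_integral_distribution.
(* [P] seen as a kernel from the one-point space, so that it composes with [k]. *)
pose l := kprobability (measurable_cst (P : pprobability Omega R) :
  measurable_fun [set: unit] _).
pose k := graph_kernel B mtv.
have E : forall C, measurable C -> distribution P X C = kcomp l k tt C.
  apply: (@measure_unique _ R _ [set A `*` C | A in measurable & C in measurable]
    (fun=> setT)).
  - exact: measurable_prod_measurableType.
  - move=> _ _ [A1 mA1 [A2 mA2 <-]] [C1 mC1 [C2 mC2 <-]].
    exists (A1 `&` C1); first exact: measurableI.
    exists (A2 `&` C2); first exact: measurableI.
    by rewrite setXI.
  - by move=> _; exists setT => //; exists setT => //; rewrite setXTT.
  - by rewrite bigcup_const.
  - move=> _ [A mA [C mC <-]].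
    rewrite [LHS]law//= integral_mkcond.
    change (kcomp l k tt (A `*` C)) with (\int[P]_w k (tt, w) (A `*` C)).
    apply: eq_integral => w _.
    rewrite graph_kernelE /= patchE.
    have [Aw|Aw] := boolP (tv w \in A).
      by rewrite in_xsectionX// ifT// inE; apply/set_mem.
    rewrite notin_xsectionX// measure0 ifF//.
    by apply/negbTE; apply: contra Aw => /set_mem Aw; apply/mem_set.
  - by move=> _; rewrite ltey_eq fin_num_measure.
rewrite (eq_measure_integral (kcomp l k tt))//; last by move=> C mC _; exact: E.
rewrite integral_kcomp//; apply: eq_integral => w _.
rewrite [LHS]ge0_integral_pushforward//; exact: measurable_pairl.
Qed.

End disintegration.

(** * Comparison of integrals and the pointwise mechanism *)

Section integral_comparison.
Local Open Scope ereal_scope.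
Context {R : realType} {d : measure_display} {X : measurableType d}
  (mu : {measure set X -> \bar R}).

(* Neither function need be measurable: the integral of a nonnegative function
   is a supremum over the simple functions below it. *)
Lemma ge0_le_integral_nomeas (f g : X -> \bar R) :
  (forall x, 0 <= f x) -> (forall x, f x <= g x) ->
  \int[mu]_x f x <= \int[mu]_x g x.
Proof.
move=> f0 fg; rewrite !ge0_integralTE//; last by move=> x; exact: le_trans (fg x).
apply: le_ereal_sup => _ [h hf <-]; exists h => // x.
exact: le_trans (hf x) (fg x).
Qed.

(** The positive part of [f - g] is dominated by [f], so a nonnegative integral rules out an
    infinite negative part. This serves to deduce from the equilibrium condition that expected
    payments are finite. *)
Lemma ge0_integralB_finite (f : X -> \bar R) (g : X -> R) :
  measurable_fun setT f -> measurable_fun setT g ->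
  (forall x, 0 <= f x) -> (forall x, (0 <= g x)%R) ->
  \int[mu]_x f x < +oo -> 0 <= \int[mu]_x (f x - (g x)%:E) ->
  \int[mu]_x (g x)%:E < +oo /\
  \int[mu]_x (f x - (g x)%:E) = \int[mu]_x f x - \int[mu]_x (g x)%:E.
Proof.
move=> mf mg f0 g0 foo fg0.
have mg' : measurable_fun setT (fun x => (g x)%:E) by exact/measurable_EFinP.
have mfg : measurable_fun setT (fun x => f x - (g x)%:E) by exact: emeasurable_funB.
set h := fun x => f x - (g x)%:E.
have hp : \int[mu]_x h^\+ x < +oo.
  apply: le_lt_trans foo; apply: ge0_le_integral => //.
  - exact: measurable_funepos.
  - move=> x _; rewrite funeposE ge_max f0 andbT /h.
    by rewrite leeBlDr// leeDl// lee_fin.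
have hn : \int[mu]_x h^\- x < +oo.
  move: fg0; rewrite integralE -/h ltNge leye_eq => fg0; apply/negP => /eqP hn.
  move: fg0; rewrite hn; move: hp.
  by case: (\int[mu]_x h^\+ x).
(* Pointwise [g <= f + h^-], and both terms on the right have finite integrals. *)
have gi : \int[mu]_x (g x)%:E < +oo.
  apply: (@le_lt_trans _ _ (\int[mu]_x (f x + h^\- x))).
    apply: ge0_le_integral => //.
    - by move=> x _; rewrite lee_fin.
    - by apply: emeasurable_funD => //; exact: measurable_funeneg.
    - move=> x _; rewrite funenegE.
      have [->|fx] := eqVneq (f x) +oo.
        by rewrite addye ?leey// -ltNye (lt_le_trans (ltNyr 0))// le_max lexx orbT.
      have fxf : f x \is a fin_num.
        by rewrite ge0_fin_numE// ltey.
      apply: (@le_trans _ _ (f x + - h x)); last by rewrite leeD2l// le_max lexx.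
      by rewrite /h fin_num_oppeB// addeA subee// add0e.
  rewrite ge0_integralD//; last exact: measurable_funeneg.
  by rewrite lte_add_pinfty.
split => //.
rewrite [LHS]integralB//; apply/integrableP; split => //.
  by under eq_integral do rewrite gee0_abs//.
by under eq_integral do rewrite gee0_abs ?lee_fin//.
Qed.

End integral_comparison.

(** * Shares and values at fixed bids *)

Section mechanism.
Context {R : realType} {n m : nat}.
Implicit Types (b : 'I_n -> m.-tuple R) (a x y : m.-tuple R).

Definition pos_part a : m.-tuple R := [tuple Num.max 0 (tnth a j) | j < m].

Lemma nonneg_pos_part a : nonneg_bid (pos_part a).
Proof. by move=> j; rewrite tnth_mktuple le_max lexx. Qed.

Lemma pos_part_id a : nonneg_bid a -> pos_part a = a.
Proof.
by move=> a0; apply: eq_from_tnth => j; rewrite tnth_mktuple; exact/max_idPr.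
Qed.

Lemma payment_ge0 a : nonneg_bid a -> 0 <= payment a.
Proof. by move=> a0; apply: sumr_ge0 => j _. Qed.

Definition rival_bid b (i : 'I_n) (j : 'I_m) : R :=
  \sum_(k < n | k != i) tnth (b k) j.

Lemma rival_bid_ge0 b i j : (forall k, nonneg_bid (b k)) -> 0 <= rival_bid b i j.
Proof. by move=> b0; apply: sumr_ge0 => k _; exact: b0. Qed.

Lemma le_rival_bid b i j :
  (forall k, nonneg_bid (b k)) -> rival_bid b i j <= total_bid b j.
Proof. by move=> b0; rewrite /total_bid (bigD1 i)//= lerDr; exact: b0. Qed.

Lemma sum_total_bid b : \sum_(j < m) total_bid b j = \sum_(k < n) payment (b k).
Proof. exact: exchange_big. Qed.

Lemma total_bid_upd b i a j :
  total_bid (upd b i a) j = tnth a j + rival_bid b i j.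
Proof.
rewrite /total_bid (bigD1 i)//= /upd eqxx; congr (_ + _).
by apply: eq_bigr => k /negbTE ->.
Qed.

Lemma alloc_in_cube z b i :
  tie_rule z -> (forall k, nonneg_bid (b k)) -> in_cube (alloc z b i).
Proof.
move=> [z0 z1] b0 j; rewrite tnth_mktuple; case: ifPn => tb.
  rewrite z0 /= (le_trans _ (z1 j))// (bigD1 i)//= lerDl.
  by apply: sumr_ge0 => k _.
have t0 : 0 <= total_bid b j by apply: sumr_ge0 => k _; exact: b0.
have tp : 0 < total_bid b j by rewrite lt_def tb.
rewrite divr_ge0//=; last exact: b0.
rewrite ler_pdivrMr// mul1r /total_bid (bigD1 i)//= lerDl.
by apply: sumr_ge0 => k _; exact: b0.
Qed.

Lemma feasible_in_cube (x : 'I_n -> m.-tuple R) i : feasible x -> in_cube (x i).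
Proof.
move=> [x0 x1] j; rewrite x0 /= (le_trans _ (x1 j))// (bigD1 i)//= lerDl.
by apply: sumr_ge0.
Qed.

(* Bidding [y p' + e] against [p] and [y p + e] against [p'] yields shares whose
   sum is at least [y], split in the proportion [p' : p]. *)
Lemma swapped_shares (y p p' e : R) : 0 <= y <= 1 -> 0 <= p -> 0 <= p' -> 0 < e ->
  exists2 s, 0 <= s <= 1 &
    y * s <= (y * p' + e) / (y * p' + e + p) /\
    y * (1 - s) <= (y * p + e) / (y * p + e + p').
Proof.
move=> /andP[y0 y1] p0 p'0 e0.
have yp : 0 <= y * p by exact: mulr_ge0.
have yp' : 0 <= y * p' by exact: mulr_ge0.
(* When both rival totals vanish, the bid [e] wins the whole resource in either case, and [s = 1]
   will do. *)
have [pp|pp] := eqVneq (p + p') 0.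
  have [-> ->] : p = 0 /\ p' = 0 by lra.
  by exists 1; [lra|rewrite !mulr0 !add0r !addr0 divff ?gt_eqF//; lra].
have {}pp : 0 < p + p' by rewrite lt_def pp addr_ge0.
have key (q q' : R) : 0 <= q -> 0 <= q' -> 0 < q + q' ->
    y * (q' / (q + q')) <= (y * q' + e) / (y * q' + e + q).
  move=> q0 q'0 qq; have yq' : 0 <= y * q' by exact: mulr_ge0.
  rewrite mulrA ler_pdivrMr// mulrAC ler_pdivlMr; last by lra.
  (* With denominators cleared, the difference of the two sides is the sum of the three quantities
     in [h1], [h2] and [h3]. *)
  have h1 : 0 <= y * q' * q' * (1 - y) by rewrite mulr_ge0 ?mulr_ge0//; lra.
  have h2 : 0 <= e * q' * (1 - y).
    by rewrite mulr_ge0 ?subr_ge0// mulr_ge0// ltW.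
  have h3 : 0 <= e * q by rewrite mulr_ge0// ltW.
  by rewrite -subr_ge0; nra.
exists (p' / (p + p')).
  by rewrite divr_ge0 ?(ltW pp)//= ler_pdivrMr// mul1r lerDr.
split; first exact: key.
have -> : 1 - p' / (p + p') = p / (p' + p).
  by rewrite [p' + p]addrC; field; rewrite gt_eqF.
by apply: key => //; rewrite addrC.
Qed.

(** Subadditivity is applied once, to [y] cut into [y s] and [y (1 - s)], with a fraction [s j] that
    may vary with the resource; monotonicity does the rest. *)
Lemma valuation_split (v : m.-tuple R -> R) (y x x' : m.-tuple R) (s : 'I_m -> R) :
  subadditive_valuation v -> in_cube y -> in_cube x -> in_cube x' ->
  (forall j, 0 <= s j <= 1) ->
  (forall j, tnth y j * s j <= tnth x j) ->
  (forall j, tnth y j * (1 - s j) <= tnth x' j) ->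
  v y <= v x + v x'.
Proof.
move=> [_ _ vmono vsub] cy cx cx' s01 ysx ysx'.
pose y1 := [tuple tnth y j * s j | j < m].
pose y2 := [tuple tnth y j * (1 - s j) | j < m].
have cy1 : in_cube y1.
  move=> j; rewrite tnth_mktuple; have /andP[a0 a1] := cy j.
  have /andP[b0 b1] := s01 j; rewrite mulr_ge0//=.
  by rewrite -[leRHS]mulr1 ler_pM.
have cy2 : in_cube y2.
  move=> j; rewrite tnth_mktuple; have /andP[a0 a1] := cy j.
  have /andP[b0 b1] := s01 j; rewrite mulr_ge0 ?subr_ge0//=.
  by rewrite -[leRHS]mulr1 ler_pM ?subr_ge0// gerBl.
have yE : vadd y1 y2 = y.
  by apply: eq_from_tnth => j; rewrite !tnth_mktuple; ring.
rewrite -yE; apply: le_trans (vsub _ _ cy1 cy2 _) _; first by rewrite yE.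
by apply: lerD; apply: vmono => // j; rewrite tnth_mktuple.
Qed.

Lemma upd_nonneg b i a k :
  (forall k, nonneg_bid (b k)) -> nonneg_bid a -> nonneg_bid (upd b i a k).
Proof. by move=> b0 a0; rewrite /upd; case: ifP. Qed.

(** The deviation of agent [i] aiming at the share [y]; here [b] will be an independent copy of the
    bids actually faced. With [e > 0] the total bid is positive, so the tie rule never decides. *)
Definition mimic_bid (y : m.-tuple R) (e : R) b (i : 'I_n) : m.-tuple R :=
  [tuple tnth y j * rival_bid b i j + e | j < m].

Lemma nonneg_mimic_bid y e b i : in_cube y -> 0 <= e ->
  (forall k, nonneg_bid (b k)) -> nonneg_bid (mimic_bid y e b i).
Proof.
move=> cy e0 b0 j; rewrite tnth_mktuple addr_ge0// mulr_ge0 ?rival_bid_ge0//.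
by have /andP[] := cy j.
Qed.

Lemma mimic_symmetrization z (v : m.-tuple R -> R) y e b b' i :
  tie_rule z -> subadditive_valuation v -> in_cube y -> 0 < e ->
  (forall k, nonneg_bid (b k)) -> (forall k, nonneg_bid (b' k)) ->
  v y <= v (alloc z (upd b i (mimic_bid y e b' i)) i) +
         v (alloc z (upd b' i (mimic_bid y e b i)) i).
Proof.
move=> hz hv cy e0 b0 b'0.
(* The fraction is chosen resource by resource; the sigma type makes the choice a function of
   [j]. *)
have ex j : {s | 0 <= s <= 1 &
    tnth y j * s <= tnth (alloc z (upd b i (mimic_bid y e b' i)) i) j /\
    tnth y j * (1 - s) <= tnth (alloc z (upd b' i (mimic_bid y e b i)) i) j}.
  apply: cid2.
  have r0 := rival_bid_ge0 i j b0; have r'0 := rival_bid_ge0 i j b'0.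
  have [s s01 [h1 h2]] := swapped_shares (cy j) r0 r'0 e0.
  have y0 : 0 <= tnth y j by have /andP[] := cy j.
  exists s => //; rewrite !tnth_mktuple !total_bid_upd /upd eqxx !tnth_mktuple.
  have tot (p p' : R) : 0 <= p -> 0 <= p' -> (tnth y j * p + e + p' == 0) = false.
    by move=> p0 p'0; apply: gt_eqF; rewrite -addrA ltr_wpDl ?mulr_ge0// ltr_wpDr.
  by rewrite !tot.
have n0 c c' : (forall k, nonneg_bid (c k)) -> (forall k, nonneg_bid (c' k)) ->
    in_cube (alloc z (upd c i (mimic_bid y e c' i)) i).
  move=> c0 c'0; apply: alloc_in_cube => // k; apply: upd_nonneg => //.
  by apply: nonneg_mimic_bid => //; exact: ltW.
apply: (@valuation_split v y _ _ (fun j => s2val (ex j))) => //.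
- exact: n0.
- exact: n0.
- by move=> j; exact: (s2valP (ex j)).
- by move=> j; have [] := s2valP' (ex j).
- by move=> j; have [] := s2valP' (ex j).
Qed.

End mechanism.

(** * Measurability of the mechanism *)

Section mechanism_measurability.
Context {R : realType} {n m : nat} {dX : measure_display} {X : measurableType dX}.
Implicit Types (f : X -> m.-tuple R) (b : 'I_n -> X -> m.-tuple R).

(** Inversion is continuous off 0, and at 0 it has the conventional value 0. *)
Lemma measurable_invr : measurable_fun [set: R] (@GRing.inv R).
Proof.
rewrite (_ : GRing.inv = fun x : R => if x == 0 then 0 else x^-1); last first.
  by apply/funext => x; case: eqP => // ->; rewrite invr0.
apply: measurable_fun_if => //.
  by apply: measurable_fun_eqr.
rewrite setTI; apply: open_continuous_measurable_fun.
  rewrite (_ : _ @^-1` _ = [set x : R | x != 0]); first exact: open_neq.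
  by apply/seteqP; split => x /=; [move=> ->|move/negbTE].
by apply/in_setP => x /= /negbT; exact: inv_continuous.
Qed.

Lemma measurable_tuple_coord f j :
  measurable_fun setT f -> measurable_fun setT (fun x => tnth (f x) j).
Proof. by move=> mf; exact: measurableT_comp (measurable_tnth j) mf. Qed.

Lemma measurable_fun_mktuple (h : 'I_m -> X -> R) :
  (forall j, measurable_fun setT (h j)) ->
  measurable_fun setT (fun x => [tuple h j x | j < m]).
Proof.
move=> mh; apply/measurable_fun_tnthP => j.
by rewrite (_ : _ \o _ = h j)//; apply/funext => x /=; rewrite tnth_mktuple.
Qed.

Lemma measurable_pos_part f :
  measurable_fun setT f -> measurable_fun setT (fun x => pos_part (f x)).
Proof.
move=> mf; apply: measurable_fun_mktuple => j.
by apply: measurable_maxr => //; exact: measurable_tuple_coord.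
Qed.

Lemma measurable_payment f :
  measurable_fun setT f -> measurable_fun setT (fun x => payment (f x)).
Proof.
by move=> mf; apply: measurable_sum => j; exact: measurable_tuple_coord.
Qed.

Lemma measurable_payment_pos_part f :
  measurable_fun setT f -> measurable_fun setT (fun x => payment (pos_part (f x))).
Proof. by move=> mf; exact: measurable_payment (measurable_pos_part mf). Qed.

Lemma measurable_rival_bid b i j : (forall k, measurable_fun setT (b k)) ->
  measurable_fun setT (fun x => rival_bid (fun k => b k x) i j).
Proof.
move=> mb; rewrite /rival_bid.
under eq_fun do rewrite -big_filter.
by apply: measurable_sum => k; exact: measurable_tuple_coord.
Qed.

Lemma measurable_alloc z b i : (forall k, measurable_fun setT (b k)) ->
  measurable_fun setT (fun x => alloc z (fun k => b k x) i).
Proof.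
move=> mb; apply: measurable_fun_mktuple => j.
have mt : measurable_fun setT (fun x => total_bid (fun k => b k x) j).
  by apply: measurable_sum => k; exact: measurable_tuple_coord.
apply: measurable_fun_ifT => //.
  exact: measurable_fun_eqr.
apply: measurable_funM; first exact: measurable_tuple_coord.
by apply: measurableT_comp => //; exact: measurable_invr.
Qed.

Lemma measurable_alloc_upd z b f i :
  (forall k, measurable_fun setT (b k)) -> measurable_fun setT f ->
  measurable_fun setT (fun x => alloc z (upd (fun k => b k x) i (f x)) i).
Proof.
move=> mb mf.
apply: (@measurable_alloc _ (fun k x => upd (fun k => b k x) i (f x) k)) => k.
by rewrite /upd; case: (k == i).
Qed.

Lemma measurable_mimic_bid y e b i : (forall k, measurable_fun setT (b k)) ->
  measurable_fun setT (fun x => mimic_bid y e (fun k => b k x) i).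
Proof.
move=> mb; apply: measurable_fun_mktuple => j.
apply: measurable_funD => //; apply: measurable_funM => //.
exact: measurable_rival_bid.
Qed.

End mechanism_measurability.

Lemma measurable_nonneg_bid (R : realType) (m : nat) :
  measurable [set b : m.-tuple R | nonneg_bid b].
Proof.
apply: (measurable_tuple_box (A := fun=> [set x : R | 0 <= x])) => _.
rewrite (_ : [set x | _] = `[0, +oo[); first exact: measurable_itv.
by apply/seteqP; split => x /=; rewrite in_itv/= andbT.
Qed.

(** * Interim deviations *)

Section symmetrization.
Local Open Scope ereal_scope.
Context {R : realType} {d : measure_display} {X : measurableType d}
  (P : probability X R).

Lemma probability_integral_cst (c : \bar R) : \int[P]_x c = c.
Proof.
by rewrite -[RHS]mule1 -(probability_setT P); exact: (integral_cst P measurableT c).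
Qed.

(** By Tonelli, exchanging the two independent variables leaves the double integral unchanged, so
    integrating [c <= H x y + H y x] bounds [c] by twice that integral, which may be infinite. *)
Lemma half_le_symmetrized_integral (c : R) (H : X -> X -> \bar R) : (0 <= c)%R ->
  measurable_fun [set: X * X] (fun p => H p.1 p.2) ->
  (forall x y, 0 <= H x y) -> (forall x y, c%:E <= H x y + H y x) ->
  (2^-1 * c)%:E <= \int[P]_x \int[P]_y H x y.
Proof.
move=> c0 mH H0 cH.
have mH' : measurable_fun [set: X * X] (fun p => H p.2 p.1).
  exact: measurableT_comp mH (measurable_fun_pair measurable_snd measurable_fst).
have mHx x : measurable_fun setT (H x).
  exact: (measurable_fun_pair2 (f := fun p => H p.1 p.2)).
have mHx' x : measurable_fun setT (H ^~ x).
  exact: (measurable_fun_pair1 (f := fun p => H p.1 p.2)).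
have mI : measurable_fun setT (fun x => \int[P]_y H x y).
  by apply: (measurable_fun_fubini_tonelli_F (m2 := P) (fun p => H p.1 p.2)).
have mI' : measurable_fun setT (fun x => \int[P]_y H y x).
  by apply: (measurable_fun_fubini_tonelli_F (m2 := P) (fun p => H p.2 p.1)).
have I0 x : 0 <= \int[P]_y H x y by exact: integral_ge0.
have I0' x : 0 <= \int[P]_y H y x by exact: integral_ge0.
set I := \int[P]_x _.
have IE : \int[P]_x \int[P]_y H y x = I.
  exact/esym/(@fubini_tonelli _ _ _ _ _ P P (fun p => H p.1 p.2)).
have : c%:E <= I + I.
  rewrite -{2}IE -ge0_integralD// -[leLHS]probability_integral_cst.
  apply: ge0_le_integral => //; first exact: emeasurable_funD.
  move=> x _; rewrite -ge0_integralD// -[leLHS]probability_integral_cst.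
  by apply: ge0_le_integral => //; exact: emeasurable_funD.
have I00 : 0 <= I by exact: integral_ge0.
move: I00; clearbody I; clear IE; case: I => [r _| _ _|]; last by rewrite leeNy_eq.
  by rewrite -EFinD !lee_fin; lra.
exact: leey.
Qed.

End symmetrization.

Section interim.
Context {R : realType} {n m : nat} {d : measure_display}
  {Omega : measurableType d} (P : probability Omega R).
Variables (bid : 'I_n -> Omega -> m.-tuple R) (z : 'I_m -> 'I_n -> R) (i : 'I_n).
Hypothesis mbid : forall k, measurable_fun setT (bid k).
Hypothesis bid_ge0 : \forall w \ae P, forall k, nonneg_bid (bid k w).
Hypothesis hz : tie_rule z.

(* Bids are nonnegative only almost surely; truncating them makes every share a
   point of the cube, so that the valuation axioms apply at every state. *)
Definition clean_bids (w : Omega) (k : 'I_n) : m.-tuple R := pos_part (bid k w).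

Definition share (beta : m.-tuple R) (w : Omega) : m.-tuple R :=
  alloc z (upd (clean_bids w) i (pos_part beta)) i.

Lemma nonneg_clean_bids w k : nonneg_bid (clean_bids w k).
Proof. exact: nonneg_pos_part. Qed.

Lemma share_in_cube beta w : in_cube (share beta w).
Proof.
apply: alloc_in_cube => // k; apply: upd_nonneg; last exact: nonneg_pos_part.
exact: nonneg_clean_bids.
Qed.

Lemma measurable_clean_bids k : measurable_fun setT (fun w => clean_bids w k).
Proof. exact: measurable_pos_part. Qed.

Lemma measurable_share (dX : measure_display) (X : measurableType dX)
    (f : X -> m.-tuple R) (g : X -> Omega) :
  measurable_fun setT f -> measurable_fun setT g ->
  measurable_fun setT (fun x => share (f x) (g x)).
Proof.
move=> mf mg; apply: (@measurable_alloc_upd _ _ _ _ _ z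
  (fun k x => clean_bids (g x) k)) => [k|]; last exact: measurable_pos_part.
exact: measurableT_comp (measurable_clean_bids k) mg.
Qed.

Variables (v : m.-tuple R -> R) (mu : {measure set (m.-tuple R) -> \bar R}).
Hypothesis hv : subadditive_valuation v.
Hypothesis mv : measurable_fun setT v.
Hypothesis mu1 : mu setT = 1%E.
Hypothesis mu_ge0 : mu [set b | nonneg_bid b] = 1%E.

Local Open Scope ereal_scope.

Definition exp_value (beta : m.-tuple R) : \bar R := \int[P]_w (v (share beta w))%:E.

Definition exp_payment : \bar R := \int[mu]_beta (payment (pos_part beta))%:E.

Lemma value_share_ge0 beta w : (0 <= v (share beta w))%R.
Proof. by have [_ v0 _ _] := hv; exact/v0/share_in_cube. Qed.

Lemma exp_value_ge0 beta : 0 <= exp_value beta.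
Proof. by apply: integral_ge0 => w _; rewrite lee_fin value_share_ge0. Qed.

Lemma value_share_le beta w : (v (share beta w) <= v [tuple 1 | j < m])%R.
Proof.
have [_ _ vmono _] := hv; have c := share_in_cube beta w.
apply: vmono => // j; first by rewrite tnth_mktuple ler01 lexx.
by have /andP[_ c1] := c j; rewrite [leRHS]tnth_mktuple.
Qed.

Lemma measurable_value_share (dX : measure_display) (X : measurableType dX)
    (f : X -> m.-tuple R) (g : X -> Omega) :
  measurable_fun setT f -> measurable_fun setT g ->
  measurable_fun setT (fun x => (v (share (f x) (g x)))%:E).
Proof.
move=> mf mg; apply/measurable_EFinP.
exact: measurableT_comp mv (measurable_share mf mg).
Qed.

Lemma measurable_exp_value : measurable_fun setT exp_value.
Proof.
apply: (measurable_fun_fubini_tonelli_F (m2 := P)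
  (fun p => (v (share p.1 p.2))%:E)) => [|p]; last by rewrite lee_fin value_share_ge0.
exact: measurable_value_share.
Qed.

Lemma exp_value_le beta : exp_value beta <= (v [tuple 1%R | j < m])%:E.
Proof.
rewrite -[leRHS](probability_integral_cst P).
apply: ge0_le_integral => //.
- by move=> w _; rewrite lee_fin value_share_ge0.
- exact: measurable_value_share.
- by move=> w _; rewrite lee_fin value_share_le.
Qed.

Lemma exp_value_integral_lty : \int[mu]_beta exp_value beta < +oo.
Proof.
apply: (@le_lt_trans _ _ (\int[mu]_beta (cst (v [tuple 1%R | j < m])%:E beta))).
  apply: ge0_le_integral => //.
  - by move=> beta _; exact: exp_value_ge0.
  - exact: measurable_exp_value.
  - by move=> beta _; exact: exp_value_le.
by rewrite integral_cst//= mu1 mule1 ltry.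
Qed.

(** The interim utility as it stands in the equilibrium condition, with untruncated bids. *)
Let raw beta := \int[P]_w (utility v z (upd (fun k => bid k w) i beta) i)%:E.

Let measurable_utility (dX : measure_display) (X : measurableType dX)
    (f : X -> m.-tuple R) (g : X -> Omega) :
  measurable_fun setT f -> measurable_fun setT g ->
  measurable_fun setT
    (fun x => (utility v z (upd (fun k => bid k (g x)) i (f x)) i)%:E).
Proof.
move=> mf mg; apply/measurable_EFinP; apply: measurable_funB.
  apply: measurableT_comp mv _.
  apply: (@measurable_alloc_upd _ _ _ _ _ z (fun k x => bid k (g x))) => // k.
  exact: measurableT_comp (mbid k) mg.
by rewrite /upd eqxx; exact: measurable_payment.
Qed.

(** The integrand is signed, so Tonelli is applied to its positive and negative parts separately. *)
Let measurable_raw : measurable_fun setT raw.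
Proof.
pose G (p : m.-tuple R * Omega) :=
  (utility v z (upd (fun k => bid k p.2) i p.1) i)%:E.
have mG : measurable_fun [set: m.-tuple R * Omega] G by exact: measurable_utility.
rewrite (_ : raw = fun beta => \int[P]_w G^\+ (beta, w) - \int[P]_w G^\- (beta, w)).
  apply: emeasurable_funB.
    apply: (measurable_fun_fubini_tonelli_F (m2 := P) G^\+) => //.
    exact: measurable_funepos.
  apply: (measurable_fun_fubini_tonelli_F (m2 := P) G^\-) => //.
  exact: measurable_funeneg.
apply/funext => beta; rewrite /raw integralE.
by congr (_ - _); apply: eq_integral => w _; rewrite ?funeposE ?funenegE.
Qed.

(** Almost surely truncation changes no bid, and the value is bounded by that of the full supply, so
    the integral splits. *)
Let rawE beta : nonneg_bid beta -> raw beta = exp_value beta - (payment beta)%:E.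
Proof.
move=> beta0.
transitivity (\int[P]_w ((v (share beta w))%:E - (payment beta)%:E)).
  apply: ae_eq_integral => //.
  - exact: measurable_utility.
  - by apply: emeasurable_funB => //; exact: measurable_value_share.
  - apply: filterS bid_ge0 => w b0 _ /=.
    rewrite /utility /share (_ : upd (clean_bids w) i (pos_part beta) =
      upd (bid^~ w) i beta); first by rewrite /upd eqxx EFinB.
    apply/funext => k; rewrite /upd /clean_bids.
    by case: ifP => _; rewrite pos_part_id.
rewrite [LHS]integralB//.
- by congr (_ - _); exact: probability_integral_cst.
- apply/integrableP; split; first exact: measurable_value_share.
  under eq_integral do rewrite gee0_abs ?lee_fin ?value_share_ge0//.
  by rewrite -/(exp_value _) (le_lt_trans (exp_value_le _))// ltry.
- exact: finite_measure_integrable_cst.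
Qed.

Hypothesis BNE : forall b', nonneg_bid b' ->
  \int[mu]_beta raw beta >= raw b'.

Lemma exp_payment_ge0 : 0 <= exp_payment.
Proof.
by apply: integral_ge0 => b _; rewrite lee_fin payment_ge0//; exact: nonneg_pos_part.
Qed.

Let mpay : measurable_fun setT (fun b : m.-tuple R => payment (pos_part b)).
Proof. exact: (@measurable_payment_pos_part _ _ _ _ id). Qed.

Let raw_ae : \int[mu]_beta raw beta =
  \int[mu]_beta (exp_value beta - (payment (pos_part beta))%:E).
Proof.
apply: ae_eq_integral => //.
- apply: emeasurable_funB; first exact: measurable_exp_value.
  by apply/measurable_EFinP.
- exists (~` [set b | nonneg_bid b]); split.
  + by apply: measurableC; exact: measurable_nonneg_bid.
  + rewrite -setTD measureD//.
    * have E : mu setT - mu [set b | nonneg_bid b] = 0 by rewrite mu1 mu_ge0 subee.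
      by rewrite setTI; exact: E.
    * exact: measurable_nonneg_bid.
    * have E : mu setT < +oo by rewrite mu1 ltry.
      exact: E.
  + move=> b /= nb b0; apply: nb => _; rewrite rawE//.
    by rewrite [in RHS]pos_part_id.
Qed.

(** Bidding zero yields a nonnegative utility, hence so does the equilibrium strategy; as values are
    bounded, the expected payment must be finite. *)
Let payment_finite : exp_payment < +oo /\ \int[mu]_beta raw beta =
  \int[mu]_beta exp_value beta - exp_payment.
Proof.
rewrite raw_ae; apply: (@ge0_integralB_finite _ _ _ mu exp_value).
- exact: measurable_exp_value.
- exact: mpay.
- exact: exp_value_ge0.
- by move=> b; apply: payment_ge0; exact: nonneg_pos_part.
- exact: exp_value_integral_lty.
- rewrite -raw_ae; have z0 : nonneg_bid (@vzero R m) by move=> j; rewrite tnth_mktuple.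
  apply: le_trans (BNE z0); rewrite rawE//.
  rewrite (_ : payment _ = 0%R) ?sube0 ?exp_value_ge0//.
  by rewrite /payment big1// => j _; rewrite tnth_mktuple.
Qed.

Lemma exp_payment_lty : exp_payment < +oo.
Proof. by have [] := payment_finite. Qed.

(** The equilibrium condition with payments moved across, so that every term is nonnegative and can
    be integrated without integrability conditions. *)
Lemma deviation_ineq b' : nonneg_bid b' ->
  exp_value b' + exp_payment <= \int[mu]_beta exp_value beta + (payment b')%:E.
Proof.
move=> b'0; have := BNE b'0; rewrite rawE//; have [pf ->] := payment_finite.
have fp : exp_payment \is a fin_num by rewrite ge0_fin_numE ?exp_payment_ge0.
rewrite leeBlDr// addeAC leeBrDr//.
Qed.

Lemma exp_payment_le : exp_payment <= \int[mu]_beta exp_value beta.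
Proof.
have z0 : nonneg_bid (@vzero R m) by move=> j; rewrite tnth_mktuple.
have := deviation_ineq z0; rewrite (_ : payment _ = 0%R).
  by rewrite adde0; apply: le_trans; rewrite leeDr// exp_value_ge0.
by rewrite /payment big1// => j _; rewrite tnth_mktuple.
Qed.


Definition exp_rival_bid j : \bar R := \int[P]_w (rival_bid (clean_bids w) i j)%:E.

Let measurable_rival j :
  measurable_fun setT (fun w => (rival_bid (clean_bids w) i j)%:E).
Proof.
apply/measurable_EFinP.
by apply: (@measurable_rival_bid _ _ _ _ _ (fun k w => clean_bids w k)) => k;
  exact: measurable_clean_bids.
Qed.

Let mimic y e w := mimic_bid y e (clean_bids w) i.

Let nonneg_mimic y e w : in_cube y -> (0 <= e)%R -> nonneg_bid (mimic y e w).
Proof. by move=> cy e0; apply: nonneg_mimic_bid => // k; exact: nonneg_clean_bids. Qed.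

Let measurable_mimic y e : measurable_fun setT (mimic y e).
Proof.
by apply: (@measurable_mimic_bid _ _ _ _ _ _ _ (fun k w => clean_bids w k)) => k;
  exact: measurable_clean_bids.
Qed.

(** The state [w] imitated and the state faced inside [exp_value] are independent with the same law,
    so [mimic_symmetrization] can be symmetrized. *)
Let half_value_le y e : in_cube y -> (0 < e)%R ->
  (2^-1 * v y)%:E <= \int[P]_w exp_value (mimic y e w).
Proof.
move=> cy e0; have [_ v0 _ _] := hv.
apply: half_le_symmetrized_integral; first exact: v0.
- apply: (@measurable_value_share _ _ (fun p => mimic y e p.1)) => //.
  by apply: measurableT_comp => //; exact: measurable_mimic.
- by move=> w w'; rewrite lee_fin value_share_ge0.
- move=> w w'; rewrite -EFinD lee_fin /share.
  rewrite !(pos_part_id (nonneg_mimic _ cy (ltW e0))).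
  by apply: mimic_symmetrization => // k; exact: nonneg_clean_bids.
Qed.

Let exp_mimic_payment y e : in_cube y -> (0 <= e)%R ->
  \int[P]_w (payment (mimic y e w))%:E =
  \sum_(j < m) (tnth y j)%:E * exp_rival_bid j + (m%:R * e)%:E.
Proof.
move=> cy e0; have y0 j : (0 <= tnth y j)%R by have /andP[] := cy j.
have r0 w j : (0 <= rival_bid (clean_bids w) i j)%R.
  by apply: rival_bid_ge0 => k; exact: nonneg_clean_bids.
transitivity (\int[P]_w \sum_(j < m)
    ((tnth y j)%:E * (rival_bid (clean_bids w) i j)%:E + e%:E)).
  apply: eq_integral => w _; rewrite /payment -sumEFin; apply: eq_bigr => j _.
  by rewrite tnth_mktuple EFinD EFinM.
rewrite ge0_integral_sum//; last 2 first.
- by move=> j; apply: emeasurable_funD => //; exact: measurable_funeM.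
- by move=> j w _; rewrite -EFinM -EFinD lee_fin addr_ge0// mulr_ge0.
have -> : (m%:R * e)%:E = \sum_(j < m) e%:E.
  by rewrite sumEFin sumr_const card_ord mulr_natl.
rewrite -big_split; apply: eq_bigr => j _ /=.
rewrite ge0_integralD//; last 2 first.
- by move=> w _; rewrite -EFinM lee_fin mulr_ge0.
- exact: measurable_funeM.
rewrite ge0_integralZl ?lee_fin//; last by move=> w _; rewrite lee_fin.
by congr (_ + _); exact: probability_integral_cst.
Qed.

(** Each realization [w] of the copy gives a pure deviation [mimic y e w], covered by the
    equilibrium condition; the inequality is averaged over [w], and the surcharge [e] is made
    arbitrarily small. *)
Lemma half_value_exp_payment_le y : in_cube y ->
  (2^-1 * v y)%:E + exp_payment <=
  \int[mu]_beta exp_value beta + \sum_(j < m) (tnth y j)%:E * exp_rival_bid j.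
Proof.
move=> cy; apply/lee_addgt0Pr => e0 e0_gt0.
(* The surcharge is paid on [m] resources, and [m * e <= e0]; the successor avoids dividing by zero
   when [m = 0]. *)
pose e := (e0 / m.+1%:R)%R.
have e_gt0 : (0 < e)%R by rewrite divr_gt0.
have mE : measurable_fun setT (fun w => exp_value (mimic y e w)).
  exact: measurableT_comp measurable_exp_value (@measurable_mimic y e).
have mp : measurable_fun setT (fun w => (payment (mimic y e w))%:E).
  apply/measurable_EFinP.
  exact: (@measurable_payment _ _ _ _ (mimic y e) (@measurable_mimic y e)).
have pay0 w : (0 <= payment (mimic y e w))%R.
  by apply: payment_ge0; apply: nonneg_mimic => //; exact: ltW.
have S0 : 0 <= \int[mu]_beta exp_value beta.
  by apply: integral_ge0 => b _; exact: exp_value_ge0.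
have key : \int[P]_w (exp_value (mimic y e w) + exp_payment) <=
    \int[P]_w (\int[mu]_beta exp_value beta + (payment (mimic y e w))%:E).
  apply: ge0_le_integral => //.
  - by move=> w _; rewrite adde_ge0 ?exp_value_ge0 ?exp_payment_ge0.
  - exact: emeasurable_funD.
  - exact: emeasurable_funD.
  - by move=> w _; apply: deviation_ineq; apply: nonneg_mimic => //; exact: ltW.
have L : \int[P]_w (exp_value (mimic y e w) + exp_payment) =
    \int[P]_w exp_value (mimic y e w) + exp_payment.
  rewrite [LHS]ge0_integralD//; first by congr (_ + _); exact: probability_integral_cst.
    by move=> w _; exact: exp_value_ge0.
  by move=> w _; exact: exp_payment_ge0.
have L' : \int[P]_w (\int[mu]_beta exp_value beta + (payment (mimic y e w))%:E) =
    \int[mu]_beta exp_value beta + \int[P]_w (payment (mimic y e w))%:E.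
  rewrite [LHS]ge0_integralD//; first by congr (_ + _); exact: probability_integral_cst.
  by move=> w _; rewrite lee_fin.
move: key; rewrite L L' exp_mimic_payment ?(ltW e_gt0)// => key.
apply: le_trans (leeD2r _ (half_value_le cy e_gt0)) _.
apply: le_trans key _; rewrite addeA leeD2l// lee_fin /e.
rewrite mulrCA ger_pMr// ler_pdivrMr// mul1r ler_nat//.
Qed.

End interim.

(** * Expectation over types *)

(** [W], the optimal welfare, is not assumed measurable, so it is never split from a sum under the
    integral: it is compared pointwise with the measurable [G = S + c - Q], whose integral is that
    of [S]. *)
Lemma half_integral_le (R : realType) (d : measure_display) (X : measurableType d)
    (P : probability X R) (W : X -> R) (S Q : X -> \bar R) (c : R) :
  (forall x, (0 <= W x)%R) ->
  measurable_fun setT S -> (forall x, (0 <= S x)%E) ->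
  measurable_fun setT Q -> (forall x, (0 <= Q x)%E) ->
  (forall x, Q x \is a fin_num) -> (\int[P]_x Q x = c%:E)%E ->
  (forall x, ((2^-1 * W x)%:E + Q x <= S x + c%:E)%E) ->
  (2^-1%:E * \int[P]_x (W x)%:E <= \int[P]_x S x)%E.
Proof.
move=> W0 mS S0 mQ Q0 Qfin Qc WQS.
have c0 : 0 <= c by rewrite -lee_fin -Qc; exact: integral_ge0.
pose G x := (S x + c%:E - Q x)%E.
have WG x : ((2^-1 * W x)%:E <= G x)%E by rewrite leeBrDr.
have G0 x : (0 <= G x)%E by apply: le_trans (WG x); rewrite lee_fin mulr_ge0.
have mG : measurable_fun setT G.
  by apply: emeasurable_funB => //; exact: emeasurable_funD.
have GE : (\int[P]_x G x = \int[P]_x S x)%E.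
  (* The integral of [S] may be infinite, so additivity is used for nonnegative functions only, and
     the finite [c] is cancelled afterwards. *)
  have : (\int[P]_x G x + c%:E = \int[P]_x S x + c%:E)%E.
    rewrite -{1}Qc -ge0_integralD//.
    rewrite -[in RHS](probability_integral_cst P c%:E) -ge0_integralD//.
    by apply: eq_integral => x _; rewrite /G subeK.
  by move/(congr1 (fun y => y - c%:E)%E); rewrite !addeK.
have : (\int[P]_x (W x)%:E <= 2%:E * \int[P]_x S x)%E.
  rewrite -GE -ge0_integralZl//.
  apply: ge0_le_integral_nomeas => x; first by rewrite lee_fin.
  apply: (@le_trans _ _ (2%:E * (2^-1 * W x)%:E)%E).
    by rewrite -EFinM lee_fin mulrA divff// mul1r.
  by rewrite lee_wpmul2l.
move=> H; apply: (@le_trans _ _ (2^-1%:E * (2%:E * \int[P]_x S x))%E).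
  by rewrite lee_wpmul2l// lee_fin.
by rewrite muleA -EFinM mulVf// mul1e.
Qed.

(** * From interim quantities to expectations over types *)

Section equilibrium.
Context {R : realType} {n m : nat} {d : measure_display}
  {Omega : measurableType d} {P : probability Omega R}
  {dT : measure_display} {T : measurableType dT}.
Variables (val : 'I_n -> T -> m.-tuple R -> R) (z : 'I_m -> 'I_n -> R)
  (B : 'I_n -> R.-pker T ~> m.-tuple R)
  (tv : 'I_n -> Omega -> T) (bid : 'I_n -> Omega -> m.-tuple R).
Hypothesis Hval : forall i t, subadditive_valuation (val i t).
Hypothesis Hval_meas : forall i, measurable_fun setT
  (fun p : T * m.-tuple R => val i p.1 p.2).
Hypothesis Hz : tie_rule z.
Hypothesis HBnn : forall i t, B i t [set b | nonneg_bid b] = 1%E.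
Hypothesis Htv_meas : forall i, measurable_fun setT (tv i).
Hypothesis Hbid_meas : forall i, measurable_fun setT (bid i).
Hypothesis Hindep : mutually_independent P (fun i w => (tv i w, bid i w)).
Hypothesis Hlaw : forall i (A : set T) (S : set (m.-tuple R)),
  measurable A -> measurable S ->
  P (tv i @^-1` A `&` bid i @^-1` S) =
  (\int[P]_(w in tv i @^-1` A) B i (tv i w) S)%E.

Local Open Scope ereal_scope.

(** The law of each bid averages the strategy over types, and every [B k t] gives mass one to
    nonnegative bids; there are finitely many agents. *)
Lemma ae_nonneg_bid : \forall w \ae P, forall k, nonneg_bid (bid k w).
Proof.
apply: filter_forall => k; exists (~` (bid k @^-1` [set b | nonneg_bid b])).
have mN : measurable (bid k @^-1` [set b | nonneg_bid b]).
  rewrite -[X in measurable X]setTI; apply: Hbid_meas => //.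
  exact: measurable_nonneg_bid.
split => //; first exact: measurableC.
rewrite probability_setC// -[X in 1 - P X]setTI -(preimage_setT (tv k)).
rewrite Hlaw//; last exact: measurable_nonneg_bid.
rewrite preimage_setT; under eq_integral do rewrite HBnn.
by rewrite probability_integral_cst subee.
Qed.

Definition mech_value i t (beta : m.-tuple R) : \bar R :=
  exp_value P bid z i (val i t) beta.
Definition interim_value i t : \bar R := \int[B i t]_beta mech_value i t beta.
Definition interim_payment i t : \bar R := exp_payment (B i t).

Lemma measurable_val i t : measurable_fun setT (val i t).
Proof. exact: (measurable_fun_pair2 (f := fun p => val i p.1 p.2)). Qed.

Lemma mech_value_ge0 i t beta : 0 <= mech_value i t beta.
Proof. exact: exp_value_ge0. Qed.

Lemma measurable_joint_value i (dX : measure_display) (X : measurableType dX)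
    (h : X -> T) (f : X -> m.-tuple R) (g : X -> Omega) :
  measurable_fun setT h -> measurable_fun setT f -> measurable_fun setT g ->
  measurable_fun setT (fun x => (val i (h x) (share bid z i (f x) (g x)))%:E).
Proof.
move=> mh mf mg; apply/measurable_EFinP.
have mp : measurable_fun setT (fun x => (h x, share bid z i (f x) (g x))).
  by apply: measurable_fun_pair => //; exact: measurable_share.
exact: measurableT_comp (Hval_meas i) mp.
Qed.

Lemma measurable_mech_value i :
  measurable_fun [set: T * m.-tuple R] (fun p => mech_value i p.1 p.2).
Proof.
apply: (measurable_fun_fubini_tonelli_F (m2 := P)
  (fun q : (T * m.-tuple R) * Omega =>
     (val i q.1.1 (share bid z i q.1.2 q.2))%:E)) => [|q]; last first.
  by rewrite lee_fin value_share_ge0.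
apply: (@measurable_joint_value i _ ((T * m.-tuple R) * Omega)%type
  (fun q => q.1.1) (fun q => q.1.2) snd) => //.
  exact: measurableT_comp measurable_fst measurable_fst.
exact: measurableT_comp measurable_snd measurable_fst.
Qed.

Lemma measurable_interim_value i : measurable_fun setT (interim_value i).
Proof.
apply: (measurable_fun_integral_finite_kernel (fun p => mech_value i p.1 p.2)).
  by move=> p; exact: mech_value_ge0.
exact: measurable_mech_value.
Qed.

Let mpay : measurable_fun setT (fun b : m.-tuple R => (payment (pos_part b))%:E).
Proof.
apply/measurable_EFinP; exact: (@measurable_payment_pos_part _ _ _ _ id).
Qed.

Let pay_ge0 (b : m.-tuple R) : 0 <= (payment (pos_part b))%:E.
Proof. by rewrite lee_fin payment_ge0//; exact: nonneg_pos_part. Qed.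

Lemma measurable_interim_payment i : measurable_fun setT (interim_payment i).
Proof.
apply: measurable_fun_integral_kernel => //.
by move=> U mU; exact: measurable_kernel.
Qed.

Lemma integral_interim_payment i :
  \int[P]_w interim_payment i (tv i w) =
  \int[P]_w (payment (pos_part (bid i w)))%:E.
Proof.
apply/esym/(ge0_integral_disintegration (Htv_meas i) (Hbid_meas i) (Hlaw i)
  (F := fun p => (payment (pos_part p.2))%:E)) => //.
exact: measurableT_comp mpay measurable_snd.
Qed.

(** The interim value draws the type and bid of [i] separately from the rivals' bids. Disintegration
    restores the joint law of type and bid, and independence allows a single state [w] for both
    draws. *)
Lemma integral_interim_value i :
  \int[P]_w interim_value i (tv i w) =
  \int[P]_w (val i (tv i w) (share bid z i (bid i w) w))%:E.
Proof.
pose X k w := (tv k w, bid k w).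
have mX k : measurable_fun setT (X k) by exact: measurable_fun_pair.
(* The zero bid filling entry [i] is overwritten by [upd] inside [F]. *)
pose Y := leave_out X snd (@vzero R m) i.
pose F (p : (T * m.-tuple R) * n.-tuple (m.-tuple R)) :=
  (val i p.1.1 (alloc z (upd (fun k => pos_part (tnth p.2 k)) i
     (pos_part p.1.2)) i))%:E.
have FE t beta w : F (t, beta, Y w) = (val i t (share bid z i beta w))%:E.
  rewrite /F /share /=; congr (val i t (alloc z _ i))%:E.
  apply/funext => k; rewrite /upd; case: ifPn => // ki.
  by rewrite /Y /leave_out tnth_mktuple (negbTE ki).
have F0 p : 0 <= F p.
  rewrite lee_fin; have [_ v0 _ _] := Hval i p.1.1; apply: v0.
  by apply: alloc_in_cube => // k; apply: upd_nonneg => [j|]; exact: nonneg_pos_part.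
have mF : measurable_fun setT F.
  apply/measurable_EFinP.
  apply: (@measurableT_comp _ _ _ _ _ _ (fun p : T * m.-tuple R => val i p.1 p.2)
    _ (fun p => (p.1.1, alloc z (upd (fun k => pos_part (tnth p.2 k)) i
     (pos_part p.1.2)) i))) => //.
  apply: measurable_fun_pair; first exact: measurableT_comp measurable_fst measurable_fst.
  apply: (@measurable_alloc_upd _ _ _ _ _ z
    (fun k (p : (T * m.-tuple R) * n.-tuple (m.-tuple R)) => pos_part (tnth p.2 k))
    (fun p => pos_part p.1.2)) => [k|].
    apply: measurable_pos_part.
    exact: measurableT_comp (measurable_tnth k) measurable_snd.
  apply: measurable_pos_part.
  exact: measurableT_comp measurable_snd measurable_fst.
transitivity (\int[P]_w F (X i w, Y w)); last first.
  by apply: eq_integral => w _; exact: FE.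
rewrite ge0_integral_independent//; last 2 first.
- by apply: measurable_leave_out => //; exact: measurable_snd.
- by move=> A C mA mC; apply: independent_leave_out => //; exact: measurable_snd.
transitivity (\int[P]_w mech_value i (tv i w) (bid i w)); last first.
  by apply: eq_integral => w _; apply: eq_integral => w' _; rewrite -FE.
apply/esym/(ge0_integral_disintegration (Htv_meas i) (Hbid_meas i) (Hlaw i)
  (F := fun p => mech_value i p.1 p.2)) => [|p].
  exact: measurable_mech_value.
exact: mech_value_ge0.
Qed.

End equilibrium.

(** * Summation over agents and the welfare bound *)

Theorem theorem3
  (R : realType) (n m : nat)
  (* underlying probability space *)
  (d : measure_display) (Omega : measurableType d) (P : probability Omega R)
  (* type space: a type t of agent i stands for the valuation [val i t] *)
  (dT : measure_display) (T : measurableType dT)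
  (val : 'I_n -> T -> m.-tuple R -> R)
  (Hval : forall i t, subadditive_valuation (val i t))
  (Hval_meas : forall i, measurable_fun setT
                 (fun p : T * m.-tuple R => val i p.1 p.2))
  (* tie-breaking rule of the mechanism *)
  (z : 'I_m -> 'I_n -> R) (Hz : tie_rule z)
  (* welfare-maximizing allocation o^v for every profile *)
  (o : ('I_n -> T) -> 'I_n -> m.-tuple R)
  (Ho : forall t : 'I_n -> T, feasible (o t) /\
          forall x, feasible x ->
            welfare (fun i => val i (t i)) x <= welfare (fun i => val i (t i)) (o t))
  (* mixed Bayesian strategies B_i : types -> distributions over bid vectors *)
  (B : 'I_n -> R.-pker T ~> m.-tuple R)
  (HBnn : forall i t, B i t [set b | nonneg_bid b] = 1%E)
  (* random types v_i ~ D_i and bids b_i ~ B_i(v_i), independent across agents *)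
  (tv : 'I_n -> Omega -> T) (bid : 'I_n -> Omega -> m.-tuple R)
  (Htv_meas : forall i, measurable_fun setT (tv i))
  (Hbid_meas : forall i, measurable_fun setT (bid i))
  (Hindep : mutually_independent P (fun i w => (tv i w, bid i w)))
  (Hlaw : forall i (A : set T) (S : set (m.-tuple R)),
            measurable A -> measurable S ->
            P (tv i @^-1` A `&` bid i @^-1` S) =
            (\int[P]_(w in tv i @^-1` A) B i (tv i w) S)%E)
  (* Bayesian Nash equilibrium condition (interim, for every type) *)
  (HBNE : forall i (t : T) (b' : m.-tuple R), nonneg_bid b' ->
            (\int[B i t]_beta
               (\int[P]_w (utility (val i t) z
                             (upd (fun k => bid k w) i beta) i)%:E)
             >= \int[P]_w (utility (val i t) z (upd (fun k => bid k w) i b') i)%:E)%E) :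
  (\int[P]_w (welfare (fun i => val i (tv i w)) (alloc z (fun k => bid k w)))%:E
   >= 2^-1%:E * \int[P]_w (welfare (fun i => val i (tv i w)) (o (fun k => tv k w)))%:E)%E.
Proof.
pose U := m.-tuple R.
have ae0 : \forall w \ae P, forall k, nonneg_bid (bid k w).
  exact: ae_nonneg_bid HBnn Hbid_meas Hlaw.
pose SV i t := interim_value (P := P) val z B bid i t.
pose PA i t := interim_payment B i t.
pose v1 i w := val i (tv i w) (share bid z i (bid i w) w).
have v1_ge0 i w : 0 <= v1 i w by exact: value_share_ge0.
have mv1 i : measurable_fun setT (fun w => (v1 i w)%:E).
  exact: (measurable_joint_value z Hval_meas Hbid_meas i (g := id)).
pose p1 i w := payment (clean_bids bid w i).
have p1_ge0 i w : 0 <= p1 i w by apply: payment_ge0; exact: nonneg_pos_part.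
have mp1 i : measurable_fun setT (fun w => (p1 i w)%:E).
  apply/measurable_EFinP.
  apply: (@measurable_payment _ _ _ _ (fun w => clean_bids bid w i)).
  exact: measurable_clean_bids.
have SV0 i t : (0 <= SV i t)%E.
  by apply: integral_ge0 => b _; exact: mech_value_ge0.
have PA0 i t : (0 <= PA i t)%E by exact: exp_payment_ge0.
have mu1 i t : B i t setT = 1%E by exact: prob_kernel.
have PAlty i t : (PA i t < +oo)%E.
  exact: (exp_payment_lty Hbid_meas ae0 Hz (Hval i t) (measurable_val Hval_meas i t)
    (mu1 i t) (HBnn i t) (HBNE i t)).
have PAfin i t : PA i t \is a fin_num by rewrite ge0_fin_numE.
have PASV i t : (PA i t <= SV i t)%E.
  exact: (exp_payment_le Hbid_meas ae0 Hz (Hval i t) (measurable_val Hval_meas i t)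
    (mu1 i t) (HBnn i t) (HBNE i t)).
have mSV i : measurable_fun setT (fun w => SV i (tv i w)).
  apply: measurableT_comp (Htv_meas i).
  exact: measurable_interim_value.
have mPA i : measurable_fun setT (fun w => PA i (tv i w)).
  apply: measurableT_comp (Htv_meas i).
  exact: measurable_interim_payment.
have ISV i : (\int[P]_w SV i (tv i w) = \int[P]_w (v1 i w)%:E)%E.
  exact: integral_interim_value.
have IPA i : (\int[P]_w PA i (tv i w) = \int[P]_w (p1 i w)%:E)%E.
  exact: (integral_interim_payment Htv_meas Hbid_meas Hlaw).
(* Equilibrium welfare is rewritten through interim values: almost surely truncation changes
   nothing, and replacing the bid of [i] by itself leaves the profile as it is. *)
have -> : (\int[P]_w (welfare (fun i => val i (tv i w))
      (alloc z (fun k => bid k w)))%:E =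
    \int[P]_w (\sum_(i < n) SV i (tv i w)))%E.
  transitivity (\int[P]_w (\sum_(i < n) (v1 i w)%:E))%E; last first.
    rewrite !ge0_integral_sum//; last by move=> i w _; rewrite lee_fin.
    by apply: eq_bigr => i _; rewrite ISV.
  apply: ae_eq_integral => //.
  - apply/measurable_EFinP; apply: measurable_sum => i.
    apply: (@measurableT_comp _ _ _ _ _ _ (fun p : T * U => val i p.1 p.2)
      _ (fun w => (tv i w, alloc z (fun k => bid k w) i))) => //.
    by apply: measurable_fun_pair => //; exact: measurable_alloc.
  - exact: emeasurable_sum.
  - apply: filterS ae0 => w b0 _; rewrite /welfare -sumEFin.
    apply: eq_bigr => i _; rewrite /v1 /share; congr (val i _ (alloc z _ i))%:E.
    apply/funext => k; rewrite /upd /clean_bids.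
    by case: eqP => [->|_]; rewrite pos_part_id.
pose EP := (\sum_(i < n) \int[P]_w (p1 i w)%:E)%E.
have EP0 : (0 <= EP)%E.
  by apply: sume_ge0 => i _; apply: integral_ge0 => w _; rewrite lee_fin.
have SPA : (\int[P]_w (\sum_(i < n) PA i (tv i w)) = EP)%E.
  by rewrite ge0_integral_sum//; apply: eq_bigr => i _.
(* Bidding zero is always available, so payments are dominated by values even
   when the expected revenue is infinite. *)
have [EPoo|EPfin] := eqVneq EP +oo%E.
  have -> : (\int[P]_w (\sum_(i < n) SV i (tv i w)) = +oo)%E.
    apply/eqP; rewrite -leye_eq -EPoo -SPA; apply: ge0_le_integral => //.
    - by move=> w _; exact: sume_ge0.
    - exact: emeasurable_sum.
    - exact: emeasurable_sum.
    - by move=> w _; exact: lee_sum.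
  exact: leey.
have {}EPfin : EP \is a fin_num by rewrite ge0_fin_numE// ltey.
(* What remains is an inequality at each state [w]: half the optimal welfare plus the interim
   payments is at most the interim values plus the expected revenue. *)
apply: (@half_integral_le _ _ _ P _ _ (fun w => \sum_(i < n) PA i (tv i w))%E (fine EP)).
- move=> w; apply: sumr_ge0 => i _; have [of_ _] := Ho (fun k => tv k w).
  have [_ v0 _ _] := Hval i (tv i w); apply: v0; exact: feasible_in_cube.
- exact: emeasurable_sum.
- by move=> w; exact: sume_ge0.
- exact: emeasurable_sum.
- by move=> w; exact: sume_ge0.
- by move=> w; apply/sum_fin_numP => i _ _.
- by rewrite SPA fineK.
move=> w; rewrite fineK//.
have [ofeas _] := Ho (fun k => tv k w); set x := o _ in ofeas *.
have [x0 x1] := ofeas.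
(* Including the bid of [i] itself gives a price per resource common to all agents; these prices sum
   to the expected revenue [EP]. *)
pose EQ j := (\int[P]_w (total_bid (clean_bids bid w) j)%:E)%E.
have t0 w' j : 0 <= total_bid (clean_bids bid w') j.
  by apply: sumr_ge0 => k _; exact: nonneg_clean_bids.
have EQ0 j : (0 <= EQ j)%E by apply: integral_ge0 => w' _; rewrite lee_fin.
have mt j : measurable_fun setT (fun w => (total_bid (clean_bids bid w) j)%:E).
  apply/measurable_EFinP; apply: measurable_sum => k.
  by apply: measurable_tuple_coord; exact: measurable_clean_bids.
have EQE : (\sum_(j < m) EQ j = EP)%E.
  rewrite /EQ /EP -!ge0_integral_sum//; last 2 first.
  - by move=> i w' _; rewrite lee_fin.
  - by move=> j w' _; rewrite lee_fin.
  by apply: eq_integral => w' _; rewrite !sumEFin sum_total_bid.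
have rEQ i j : (exp_rival_bid P bid i j <= EQ j)%E.
  apply: ge0_le_integral_nomeas => w'; rewrite lee_fin.
    by apply: rival_bid_ge0 => k; exact: nonneg_clean_bids.
  by apply: le_rival_bid => k; exact: nonneg_clean_bids.
(* The state [w] being fixed, [x i] is a constant vector of the cube and serves as the target share
   of agent [i]. *)
apply: (@le_trans _ _ (\sum_(i < n) (SV i (tv i w) +
    \sum_(j < m) (tnth (x i) j)%:E * EQ j)))%E.
  rewrite /welfare mulr_sumr -sumEFin -big_split; apply: lee_sum => i _ /=.
  apply: le_trans (half_value_exp_payment_le Hbid_meas ae0 Hz (Hval i (tv i w))
    (measurable_val Hval_meas i (tv i w)) (mu1 i (tv i w)) (HBnn i (tv i w))
    (HBNE i (tv i w)) (feasible_in_cube i ofeas)) _.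
  by apply: leeD2l; apply: lee_sum => j _; rewrite lee_wpmul2l// lee_fin.
(* Summed by resource, the costs are at most [EQ j] each, since the shares of resource [j] in [x]
   total at most 1. *)
rewrite big_split /= leeD2l// exchange_big /= -EQE; apply: lee_sum => j _.
rewrite -ge0_sume_distrl; last by move=> i _; rewrite lee_fin.
by rewrite -[leRHS]mul1e lee_wpmul2r// sumEFin lee_fin.
Qed.
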